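(* Assume that $b$ satisfies (A1) and (A2). For $\varepsilon>0$ let $X^{\varepsilon}$ be the solution of $$dX_t^{\varepsilon}=b(X_t^{\varepsilon})\,dt+\varepsilon\,dW_t,\qquad X_0^{\varepsilon}=0,$$ and let $R_t^{\varepsilon}=|X_t^{\varepsilon}|$. Then there is a constant $c>0$, independent of $\varepsilon$, such that for any fixed $\varepsilon>0$, almost surely, $$\limsup_{t\to0}\frac{R_t^{\varepsilon}}{\varepsilon\sqrt{2t\log\log(1/t)}}\ \ge\ c .$$
   Context: $W$ is a $d$-dimensional standard Brownian motion on a filtered probability space $(\Omega,\mathcal F,\{\mathcal F_t\},\mathbb P)$ satisfying the usual conditions. The drift $b:\mathbb R^d\to\mathbb R^d$ is bounded, so that the SDE has a unique strong solution for each $\varepsilon>0$. The assumptions are: (A1) $b$ is continuous, $b(0)=0$, and $0\notin \mathrm{Int}\{x\in\mathbb R^d: b(x)=0\}$. (A2) There are $\delta>0$ and a continuous function $\omega:[0,\infty)\to[0,\infty)$ with $\omega(0)=0$ and $\omega>0$ on $(0,\delta]$ such that $|b(x)-b(y)|\le\omega(|x-y|)$ for all $x,y\in\mathbb R^d$, $\int_0^{\delta}\frac{dr}{\omega(r)}<\infty$, and $\langle b(x),x\rangle\ge-\omega(|x|)|x|$ for all $x$ in the open ball $B_\delta(0)$. *)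

(* Defs.v *)
From HB Require Import structures.
From mathcomp Require Import all_boot all_order all_algebra.
From mathcomp Require Import all_classical all_reals all_analysis.

Set Implicit Arguments.
Unset Strict Implicit.
Unset Printing Implicit Defensive.

Import Order.TTheory GRing.Theory Num.Theory.
Import numFieldTopology.Exports numFieldNormedType.Exports.

Local Open Scope classical_set_scope.
Local Open Scope ring_scope.

(* The library norm `|x| on 'rV[R]_d is the sup norm, hence the Euclidean
   structure below.  Both norms induce the library topology on 'rV[R]_d. *)
Definition dotp (R : realType) (d : nat) (x y : 'rV[R]_d) : R :=
  \sum_(i < d) x 0 i * y 0 i.

Definition enorm (R : realType) (d : nat) (x : 'rV[R]_d) : R :=
  Num.sqrt (dotp x x).

Definition borel_rV (R : realType) (d : nat) : set (set 'rV[R]_d) :=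
  <<s [set U : set 'rV[R]_d | open U] >>.

(* Time is a real number, of which only the values t >= 0 are constrained. *)
Record usual_filtration (R : realType) (disp : measure_display)
    (Omega : measurableType disp) (P : probability Omega R)
    (F : R -> set (set Omega)) : Prop := UsualFiltration {
  uf_sigma : forall t, 0 <= t -> sigma_algebra setT (F t) ;
  uf_sub : forall t, 0 <= t -> F t `<=` measurable ;
  uf_mono : forall s t : R, 0 <= s -> s <= t -> F s `<=` F t ;
  uf_complete : measure_is_complete P ;
  uf_null : P.-negligible `<=` F 0 ;
  uf_right_cts : forall t, 0 <= t -> F t = \bigcap_(s in `]t, +oo[) F s
}.

Definition adapted (R : realType) (d : nat) (Omega : Type)
    (F : R -> set (set Omega)) (X : R -> Omega -> 'rV[R]_d) : Prop :=
  forall t, 0 <= t -> forall B, borel_rV B -> F t (X t @^-1` B).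

(* In bm_gaussian the law of W_t - W_s, N(0, (t - s) I_d), is the product of
   its one-dimensional marginals; normal_prob takes the standard deviation. *)
Record brownian_motion (R : realType) (d : nat) (disp : measure_display)
    (Omega : measurableType disp) (P : probability Omega R)
    (F : R -> set (set Omega)) (W : R -> Omega -> 'rV[R]_d) : Prop :=
  BrownianMotion {
  bm_adapted : adapted F W ;
  bm_start : {ae P, forall w, W 0 w = 0} ;
  bm_continuous :
    {ae P, forall w, {within `[0, +oo[, continuous (fun t => W t w)}} ;
  bm_indep : forall s t : R, 0 <= s -> s < t ->
    forall A (B : set 'rV[R]_d), F s A -> borel_rV B ->
      P (A `&` [set w | B (W t w - W s w)])
      = (P A * P [set w | B (W t w - W s w)%R])%E ;
  bm_gaussian : forall s t : R, 0 <= s -> s < t ->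
    forall B : 'I_d -> set R, (forall i, measurable (B i)) ->
      P [set w | forall i, B i ((W t w - W s w) 0 i)]
      = (\prod_(i < d) normal_prob 0 (Num.sqrt (t - s)) (B i))%E
}.

(* dX_t = b(X_t) dt + eps dW_t, X_0 = 0: the noise is additive, so the integral
   form of the equation involves only a pathwise integral, taken here
   coordinate by coordinate. *)
Record sde_solution (R : realType) (d : nat) (disp : measure_display)
    (Omega : measurableType disp) (P : probability Omega R)
    (F : R -> set (set Omega)) (W : R -> Omega -> 'rV[R]_d)
    (b : 'rV[R]_d -> 'rV[R]_d) (eps : R) (X : R -> Omega -> 'rV[R]_d) : Prop :=
  SdeSolution {
  sde_adapted : adapted F X ;
  sde_continuous :
    {ae P, forall w, {within `[0, +oo[, continuous (fun t => X t w)}} ;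
  sde_start : {ae P, forall w, X 0 w = 0} ;
  sde_eq : {ae P, forall w, forall t, 0 <= t -> forall i,
    X t w 0 i = \int[lebesgue_measure]_(s in `[0, t]) (b (X s w) 0 i)
                + eps * W t w 0 i}
}.

Definition assumption_A1 (R : realType) (d : nat)
    (b : 'rV[R]_d -> 'rV[R]_d) : Prop :=
  [/\ continuous b, b 0 = 0 & ~ interior [set x | b x = 0] 0].

(* omega is a function on [0, +oo[; its values on negative reals are
   irrelevant. *)
Definition assumption_A2 (R : realType) (d : nat)
    (b : 'rV[R]_d -> 'rV[R]_d) : Prop :=
  exists (delta : R) (omega : R -> R),
    0 < delta /\
    {within `[0, +oo[, continuous omega} /\
    (forall r, 0 <= r -> 0 <= omega r) /\
    omega 0 = 0 /\
    (forall r, 0 < r <= delta -> 0 < omega r) /\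
    (forall x y, enorm (b x - b y) <= omega (enorm (x - y))) /\
    (\int[lebesgue_measure]_(r in `]0%R, delta]) ((omega r)^-1)%:E < +oo)%E /\
    (forall x, enorm x < delta -> - omega (enorm x) * enorm x <= dotp (b x) x).

(* Main.v *)
Require Import Defs.
From HB Require Import structures.
From mathcomp Require Import all_boot all_order all_algebra.
From mathcomp Require Import all_classical all_reals all_analysis.
From mathcomp Require Import measurable_realfun ring lra.

(** Because the noise is additive and the drift is bounded by M, the solution
    differs from eps * W_t by at most M * t, which is negligible against
    eps * sqrt (2 t log log (1/t)) as t tends to 0.  The bound is therefore a
    weak form, with a non-optimal constant, of the lower half of the law of the
    iterated logarithm for one coordinate of W.

    Take the times t_n = exp (- (n + 1)), so that log (1/t_n) = n + 1.  The
    increment of the coordinate over [t_(n+1), t_n] is Gaussian, and it exceeds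
    sqrt (ln (n + 1)) standard deviations with probability at least
    K / (n + 1) ([normal_prob_tail_ge], [probability_large_increment]).  These
    probabilities have a divergent sum, and the increments are independent, so
    by the second Borel-Cantelli lemma ([second_Borel_Cantelli]) infinitely
    many of them are that large almost surely ([ae_large_increments]).

    A large increment forces W to be large at one of its two endpoints, and
    t_(n+1) is again one of the times considered, with a smaller value of the
    rate; so half of the size of the increment is always available
    ([ae_lil_lower]).  This yields a quarter of the rate along infinitely many
    t_n, and half of that survives the drift. *)

Set Implicit Arguments.
Unset Strict Implicit.
Unset Printing Implicit Defensive.

Import Order.TTheory GRing.Theory Num.Theory.
Import numFieldTopology.Exports numFieldNormedType.Exports.

Local Open Scope classical_set_scope.
Local Open Scope ring_scope.

(** * The second Borel-Cantelli lemma *)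

Lemma one_subr_prod_le_expR (R : realType) (u : nat -> R) (N m : nat) :
  (forall k, u k <= 1) ->
  \prod_(N <= k < m) (1 - u k) <= expR (- \sum_(N <= k < m) u k).
Proof.
move=> u1; rewrite -sumrN expR_sum; apply: ler_prod => k _.
by rewrite subr_ge0 u1 /= expR_ge1Dx.
Qed.

(** Independence is required in the form in which it comes out of a filtration
    run backwards in time: the complement of E N is independent of every finite
    intersection of complements of later events.  Then no event from N to m - 1
    occurs with probability the product of the 1 - P (E k), which is at most
    the exponential of minus a divergent partial sum. *)
Lemma second_Borel_Cantelli (R : realType) (disp : measure_display)
    (Omega : measurableType disp) (P : probability Omega R)
    (E : nat -> set Omega) :
  (forall n, measurable (E n)) ->
  (forall N m, (N < m)%N ->
    P (\big[setI/setT]_(N <= k < m) ~` E k)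
    = (P (~` E N) * P (\big[setI/setT]_(N.+1 <= k < m) ~` E k))%E) ->
  ~ cvgn (series (fun n => fine (P (E n)))) ->
  {ae P, forall w, forall N, exists2 n, (N <= n)%N & E n w}.
Proof.
move=> mE indep dvg.
pose p n := fine (P (E n)).
have pE n : P (E n) = (p n)%:E.
  by rewrite fineK// fin_num_measure.
have p0 n : 0 <= p n by rewrite -lee_fin -pE.
have p1 n : p n <= 1 by rewrite -lee_fin -pE probability_le1.
have mC k : measurable (~` E k) by exact: measurableC.
have prodE N m : P (\big[setI/setT]_(N <= k < m) ~` E k)
    = (\prod_(N <= k < m) (1 - p k))%:E.
  have [l] := ubnP (m - N); elim: l N => // l IH N lN.
  have [mN|Nm] := leqP m N; first by rewrite !big_geq// probability_setT.
  rewrite indep// IH; last first.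
    by rewrite (leq_trans _ (lN : (m - N <= l)%N))// ltn_sub2l.
  by rewrite [in RHS]big_ltn// EFinM probability_setC// pE -EFinB.
apply: ae_foralln => N.
pose A := \bigcap_(k in [set k | (N <= k)%N]) ~` E k.
have mA : measurable A by apply: bigcap_measurable => //; exists N => /=.
exists A; split=> //; last first.
  by move=> w /= noE k /= Nk Ekw; apply: noE; exists k.
(* The maximum with N keeps the range N <= k < maxn N m meaningful for all m. *)
have PA m : (P A <= (expR (series p N - series p (maxn N m)))%:E)%E.
  apply: (@le_trans _ _ (P (\big[setI/setT]_(N <= k < maxn N m) ~` E k))).
    apply: le_measure; rewrite ?inE//.
      by apply: bigsetI_measurable.
    rewrite -bigcap_seq => w Aw k /=.
    by rewrite mem_index_iota => /andP[Nk _]; exact: Aw.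
  rewrite prodE lee_fin (le_trans (one_subr_prod_le_expR _ _ p1))//.
  by rewrite -sub_series_geq ?leq_maxl// opprB.
apply/eqP; rewrite -measure_le0; apply/lee_addgt0Pr => e e0; rewrite add0e.
have nd : nondecreasing_seq (series p) by exact: nondecreasing_series.
have /cvgryPge/(_ (series p N - ln e)) [m _ /(_ m (leqnn m)) /= hm] :
    series p n @[n --> \oo] --> +oo by exact: nondecreasing_dvgn_lt.
apply: (le_trans (PA m)); rewrite lee_fin -[leRHS]lnK ?posrE// ler_expR.
rewrite lerBlDr -lerBlDl (le_trans hm)//.
by apply: nd; rewrite leq_maxr.
Qed.

(** * Gaussian increments *)

(** Restrict the tail to the interval of length s starting at a * s, on which
    the density is at least its value at (a + 1) * s, and use
    (a + 1)^2 / 2 <= a^2 + 1.  The exponent a^2, instead of the sharp a^2 / 2,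
    makes the threshold sqrt (ln n) give a multiple of the harmonic series. *)
Lemma normal_prob_tail_ge (R : realType) (a s : R) : 0 <= a -> 0 < s ->
  ((expR (- (a ^+ 2 + 1)) / Num.sqrt (pi *+ 2))%:E
   <= normal_prob 0 s `[(a * s)%R, +oo[)%E.
Proof.
move=> a0 s0.
set h := expR (- (a ^+ 2 + 1)).
have -> : h / Num.sqrt (pi *+ 2) = normal_peak s * h * s.
  rewrite /normal_peak -mulrnAr sqrtrM ?sqr_ge0// sqrtr_sqr gtr0_norm//.
  rewrite invfM; field.
  by apply/andP; split; rewrite gt_eqF// sqrtr_gt0 mulrn_wgt0// pi_gt0.
apply: (@le_trans _ _ (normal_prob 0 s `[(a * s)%R, ((a + 1) * s)%R]));
  last first.
  apply: le_measure; rewrite ?inE//=.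
  by apply: subset_itv => //; rewrite bnd_simp.
have -> : (normal_peak s * h * s)%:E =
    (\int[lebesgue_measure]_(x in `[(a * s)%R, ((a + 1) * s)%R])
        (normal_peak s * h)%:E)%E.
  rewrite integral_cst//= lebesgue_measure_itv/= lte_fin ifT.
    by rewrite -EFinD -EFinM; congr EFin; ring.
  by rewrite ltr_pM2r// ltrDl.
apply: ge0_le_integral => //=.
- by move=> x _; rewrite lee_fin mulr_ge0 ?normal_peak_ge0 ?expR_ge0.
- apply/measurable_EFinP; apply: measurable_funTS.
  exact: measurable_normal_pdf.
move=> x; rewrite in_itv/= => /andP[ax xa].
rewrite lee_fin normal_pdfE ?gt_eqF// ler_pM2l ?normal_peak_gt0 ?gt_eqF//.
rewrite /normal_fun ler_expR subr0 mulNr lerN2.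
rewrite ler_pdivrMr ?mulrn_wgt0 ?exprn_gt0//.
have x0 : 0 <= x by rewrite (le_trans _ ax)// mulr_ge0// ltW.
apply: (@le_trans _ _ (((a + 1) * s) ^+ 2)).
  by rewrite lerXn2r ?nnegrE ?(le_trans x0).
rewrite -subr_ge0.
have -> : (a ^+ 2 + 1) * (s ^+ 2 *+ 2) - ((a + 1) * s) ^+ 2
  = ((a - 1) * s) ^+ 2 by ring.
exact: sqr_ge0.
Qed.

Lemma open_coord_preimage (R : realType) (d : nat) (i : 'I_d) (U : set R) :
  open U -> open ((fun x : 'rV[R]_d => x 0 i) @^-1` U).
Proof. by move=> oU; apply: open_comp => // x _; exact: coord_continuous. Qed.

(** The threshold a counts standard deviations of the increment. *)
Definition large_increment (R : realType) (d : nat) (Omega : Type)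
    (W : R -> Omega -> 'rV[R]_d) (i : 'I_d) (s t a : R) : set Omega :=
  [set w | a * Num.sqrt (t - s) <= (W t w - W s w) 0 i].

(** Both W s and W t are F t-measurable.  F t is turned into a measurable type
    of its own so that the measurability of a difference of real functions
    applies. *)
Lemma filtration_large_increment (R : realType) (d : nat)
    (disp : measure_display) (Omega : measurableType disp)
    (P : probability Omega R) (F : R -> set (set Omega))
    (W : R -> Omega -> 'rV[R]_d) (i : 'I_d) (s t a : R) :
  usual_filtration P F -> brownian_motion P F W -> 0 <= s -> s <= t ->
  F t (large_increment W i s t a).
Proof.
move=> hF hW s0 st; have t0 := le_trans s0 st.
have FtE : <<s F t >> = F t by exact/sigma_algebra_id/(uf_sigma hF).
have mW u : 0 <= u -> u <= t ->
    measurable_fun setT (fun w : g_sigma_algebraType (F t) => W u w 0 i).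
  move=> u0 ut; apply: (measurability _ (RGenOInfty.measurableE R)) => //.
  move=> _ [_ [x ->] <-]; rewrite setTI.
  suff : <<s F t >> (W u @^-1` ((fun y => y 0 i) @^-1` `]x, +oo[)) by [].
  rewrite FtE; apply: (uf_mono hF u0 ut); apply: (bm_adapted hW) => //.
  by apply: sub_sigma_algebra; apply: open_coord_preimage; exact: interval_open.
rewrite -FtE.
have := measurable_funB (mW t t0 (lexx _)) (mW s s0 st).
move=> /(_ measurableT `[a * Num.sqrt (t - s), +oo[%classic (measurable_itv _)).
rewrite setTI => mI.
suff -> : large_increment W i s t a = (fun w => W t w 0 i - W s w 0 i) @^-1`
  `[a * Num.sqrt (t - s), +oo[ by exact: mI.
by apply/seteqP; split=> w; rewrite /large_increment/= in_itv/= andbT !mxE.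
Qed.

Lemma probability_large_increment (R : realType) (d : nat)
    (disp : measure_display) (Omega : measurableType disp)
    (P : probability Omega R) (F : R -> set (set Omega))
    (W : R -> Omega -> 'rV[R]_d) (i : 'I_d) (s t a : R) :
  brownian_motion P F W -> 0 <= s -> s < t -> 0 <= a ->
  ((expR (- (a ^+ 2 + 1)) / Num.sqrt (pi *+ 2))%:E
   <= P (large_increment W i s t a))%E.
Proof.
move=> hW s0 st a0.
pose B j : set R :=
  if j == i then `[a * Num.sqrt (t - s), +oo[%classic else setT.
have mB j : measurable (B j) by rewrite /B; case: ifP.
have -> : large_increment W i s t a
    = [set w | forall j, B j ((W t w - W s w) 0 j)].
  apply/seteqP; split=> w; rewrite /large_increment/=.
    by move=> h j; rewrite /B; case: eqP => [->|//]; rewrite /= in_itv/= andbT.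
  by move=> /(_ i); rewrite /B eqxx /= in_itv/= andbT.
rewrite (bm_gaussian hW s0 st mB) (bigD1 i)//= big1 ?mule1; last first.
  by move=> j ji; rewrite /B (negbTE ji) probability_setT.
by rewrite /B eqxx; apply: normal_prob_tail_ge; rewrite // sqrtr_gt0 subr_gt0.
Qed.

Lemma indep_large_increment (R : realType) (d : nat)
    (disp : measure_display) (Omega : measurableType disp)
    (P : probability Omega R) (F : R -> set (set Omega))
    (W : R -> Omega -> 'rV[R]_d) (i : 'I_d) (s t a : R)
    (A : set Omega) :
  brownian_motion P F W -> 0 <= s -> s < t -> F s A ->
  P (A `&` ~` large_increment W i s t a)
  = (P A * P (~` large_increment W i s t a))%E.
Proof.
move=> hW s0 st FA.
have <- : [set w | ((fun x : 'rV[R]_d => x 0 i)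
    @^-1` `]-oo, a * Num.sqrt (t - s)[) (W t w - W s w)]
    = ~` large_increment W i s t a.
  apply/seteqP; split=> w; rewrite /large_increment/= in_itv/= ltNge.
    by move/negP.
  by move=> ?; apply/negP.
apply: (bm_indep hW) => //.
by apply: sub_sigma_algebra; apply: open_coord_preimage; exact: interval_open.
Qed.

Lemma sigma_algebra_bigsetI_setC (T : Type) (G : set (set T)) (s : seq nat)
    (E : nat -> set T) :
  sigma_algebra setT G -> (forall k, k \in s -> G (E k)) ->
  G (\big[setI/setT]_(k <- s) ~` E k).
Proof.
move=> [G0 GD GU] GE.
have GC A : G A -> G (~` A) by move=> /GD; rewrite setTD.
rewrite -bigcap_seq -setC_bigcup bigcup_mkcond; apply/GC/GU => k.
by case: ifPn => // /[!inE]; exact: GE.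
Qed.

(** * Large increments at exponentially small times *)

Definition log_scale (R : realType) (n : nat) : R := expR (- n.+1%:R).

Lemma log_scale_gt0 (R : realType) n : 0 < log_scale R n.
Proof. exact: expR_gt0. Qed.

Lemma log_scale_lt (R : realType) n : log_scale R n.+1 < log_scale R n.
Proof. by rewrite ltr_expR ltrN2 ltr_nat. Qed.

(** The n-th event lies in F (t_n) and is independent of F (t_(n+1)), which
    contains all the later ones; its probability is at least a fixed multiple
    of the n-th term of the harmonic series. *)
Lemma ae_large_increments (R : realType) (d : nat)
    (disp : measure_display) (Omega : measurableType disp)
    (P : probability Omega R) (F : R -> set (set Omega))
    (W : R -> Omega -> 'rV[R]_d) (i : 'I_d) :
  usual_filtration P F -> brownian_motion P F W ->
  {ae P, forall w, forall N, exists2 n, (N <= n)%N &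
     large_increment W i (log_scale R n.+1) (log_scale R n)
       (Num.sqrt (ln n.+1%:R)) w}.
Proof.
move=> hF hW; have T0 n := ltW (log_scale_gt0 R n).
set E := fun n => large_increment W i (log_scale R n.+1) (log_scale R n)
  (Num.sqrt (ln n.+1%:R)).
have FE n : F (log_scale R n) (E n).
  apply: (filtration_large_increment _ _ hF hW) => //.
  exact/ltW/log_scale_lt.
have mE n : measurable (E n) by exact: (uf_sub hF (T0 n)).
apply: second_Borel_Cantelli => // [N m Nm|].
  rewrite big_ltn// setIC muleC; apply: (indep_large_increment _ _ hW) => //.
    exact: log_scale_lt.
  apply: sigma_algebra_bigsetI_setC; first exact: (uf_sigma hF).
  move=> k; rewrite mem_index_iota => /andP[Nk _].
  by apply: (uf_mono hF _ _ (FE k)) => //; rewrite ler_expR lerN2 ler_nat.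
pose K : R := expR (- 1) / Num.sqrt (pi *+ 2).
have K0 : 0 < K by rewrite divr_gt0 ?expR_gt0// sqrtr_gt0 mulrn_wgt0// pi_gt0.
have pE n : K * harmonic n <= fine (P (E n)).
  rewrite -lee_fin fineK ?fin_num_measure//.
  apply: le_trans; last first.
    by apply: (probability_large_increment _ hW) => //; exact: log_scale_lt.
  rewrite lee_fin sqr_sqrtr ?ln_ge0 ?ler1n// opprD expRD expRN lnK ?posrE//.
  by rewrite mulrC -mulrA.
move=> cvgE; apply: (@dvg_harmonic R).
have : cvgn (series (K *: (@harmonic R))).
  apply: (series_le_cvg _ _ pE cvgE) => n.
  - by rewrite mulr_ge0 ?(ltW K0) ?harmonic_ge0.
  - exact: fine_ge0.
move=> /(is_cvg_seriesZ (k := K^-1)).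
by rewrite scalerA mulVf ?gt_eqF// scale1r.
Qed.

Definition lil_rate (R : realType) (t : R) : R :=
  Num.sqrt (2 * t * ln (ln (1 / t))).

Lemma lil_rate_log_scale (R : realType) n :
  lil_rate (log_scale R n) = Num.sqrt (2 * log_scale R n * ln n.+1%:R).
Proof. by rewrite /lil_rate /log_scale div1r -expRN opprK expRK. Qed.

Lemma log_scaleS_le_half (R : realType) n :
  log_scale R n.+1 <= log_scale R n / 2.
Proof.
rewrite /log_scale -(natr1 n.+1) opprD expRD ler_pM2l ?expR_gt0//.
rewrite expRN lef_pV2 ?posrE ?expR_gt0//.
by have := expR_ge1Dx (1 : R).
Qed.

(** Reduces to (n + 2) <= (n + 1)^2, which fails at n = 0. *)
Lemma lil_rate_log_scaleS_le (R : realType) n : (0 < n)%N ->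
  lil_rate (log_scale R n.+1) <= lil_rate (log_scale R n).
Proof.
move=> n0; rewrite !lil_rate_log_scale ler_wsqrtr//.
have lnS : ln n.+2%:R <= 2 * ln n.+1%:R :> R.
  rewrite mulr_natl -lnXn ?ltr0n// ler_ln ?posrE ?exprn_gt0 ?ltr0n//.
  rewrite -natrX ler_nat expnS expn1 mulSn -[n.+2]addn1 leq_add2l.
  by rewrite muln_gt0 n0.
have ln0 : 0 <= ln n.+1%:R :> R by rewrite ln_ge0// ler1n.
have := log_scaleS_le_half R n; have := log_scale_gt0 R n.+1.
have := log_scale_gt0 R n.
move: lnS ln0; set l := ln _; set l' := ln _; set t := log_scale _ _.
set t' := log_scale _ _ => ll l0 t0 t'0 tt.
rewrite -!mulrA ler_pM2l//.
apply: (@le_trans _ _ (t' * (2 * l'))); first by rewrite ler_pM2l.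
have := ler_wpM2r l0 tt; lra.
Qed.

(** The length of [t_(n+1), t_n] is at least t_n / 2, so the threshold of
    the n-th large increment is at least half of the rate at t_n. *)
Lemma lil_rate_le_large_increment_bound (R : realType) n :
  lil_rate (log_scale R n) / 2
  <= Num.sqrt (ln n.+1%:R) * Num.sqrt (log_scale R n - log_scale R n.+1).
Proof.
have ln0 : 0 <= ln n.+1%:R :> R by rewrite ln_ge0// ler1n.
have tt := log_scaleS_le_half R n.
rewrite lil_rate_log_scale -sqrtrM//.
have -> : (2 : R) = Num.sqrt (2 ^+ 2) by rewrite sqrtr_sqr ger0_norm.
rewrite -sqrtrV// -sqrtrM; last first.
  by rewrite !mulr_ge0// ltW// log_scale_gt0.
rewrite ler_wsqrtr// sqrtr_sqr ger0_norm//.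
have -> : 2 * log_scale R n * ln n.+1%:R / 2 ^+ 2
  = ln n.+1%:R * (log_scale R n / 2) by field.
by rewrite ler_wpM2l//; lra.
Qed.

Lemma sqrt_log_scale_le_lil_rate (R : realType) n : (0 < n)%N ->
  Num.sqrt (log_scale R n) <= lil_rate (log_scale R n).
Proof.
move=> n0; rewrite lil_rate_log_scale ler_wsqrtr// mulrAC ler_peMl//.
  exact/ltW/log_scale_gt0.
(* ln 2 >= 1 / 2, from exp (- 1 / 2) >= 1 - 1 / 2. *)
suff ln2 : 2^-1 <= ln 2 :> R.
  apply: (@le_trans _ _ (2 * ln 2)); first by lra.
  by rewrite ler_pM2l// ler_ln ?posrE// ?ltr0n// ler_nat.
rewrite -ler_expR lnK ?posrE// -[leLHS]invrK.
rewrite invf_ple ?posrE ?invr_gt0 ?expR_gt0//.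
by rewrite -expRN (le_trans _ (expR_ge1Dx _))//; lra.
Qed.

(** If the increment over [t_(n+1), t_n] is large, then so is W at t_n or at
    t_(n+1); in the second case the bound at t_n transfers to t_(n+1) since the
    rate is smaller there. *)
Lemma ae_lil_lower (R : realType) (d : nat)
    (disp : measure_display) (Omega : measurableType disp)
    (P : probability Omega R) (F : R -> set (set Omega))
    (W : R -> Omega -> 'rV[R]_d) (i : 'I_d) :
  usual_filtration P F -> brownian_motion P F W ->
  {ae P, forall w, forall N, exists2 n, (N <= n)%N &
    lil_rate (log_scale R n) / 4 <= `|W (log_scale R n) w 0 i|}.
Proof.
move=> hF hW; have := ae_large_increments i hF hW.
(* n >= 1 is imposed for the monotonicity of the rate. *)
apply: filterS => w hw N; have [n] := hw (maxn N 1).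
rewrite geq_max => /andP[Nn n0]; rewrite /large_increment/= !mxE => inc.
have inc' := le_trans (lil_rate_le_large_increment_bound R n) inc.
have [hn|hn] := leP (lil_rate (log_scale R n) / 4)
  `|W (log_scale R n) w 0 i|.
  by exists n.
exists n.+1; first exact: leqW.
have := lil_rate_log_scaleS_le R n0.
have := ler_norm (W (log_scale R n) w 0 i).
have := ler_norm (- W (log_scale R n.+1) w 0 i); rewrite normrN.
by lra.
Qed.

(** * The drift is negligible *)

Lemma normr_coord_le_enorm (R : realType) (d : nat) (x : 'rV[R]_d) (i : 'I_d) :
  `|x 0 i| <= enorm x.
Proof.
rewrite -sqrtr_sqr ler_wsqrtr// /dotp (bigD1 i)//= expr2 lerDl.
by apply: sumr_ge0 => j _; rewrite -expr2 sqr_ge0.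
Qed.

Lemma normr_Rintegral_itv_le (R : realType) (f : R -> R) (M t : R) : 0 <= t ->
  {within `[0, t], continuous f} -> (forall s, `|f s| <= M) ->
  `|\int[lebesgue_measure]_(s in `[0, t]) f s| <= M * t.
Proof.
move=> t0 cf fM.
have intf : lebesgue_measure.-integrable `[0, t] (EFin \o f).
  by apply: continuous_compact_integrable => //; exact: segment_compact.
apply: (le_trans (le_normr_Rintegral _ intf)) => //.
have -> : M * t = \int[lebesgue_measure]_(s in `[0, t]) M.
  rewrite Rintegral_cst//= lebesgue_measure_itv/= lte_fin.
  have [_|t0'] := ltP; first by rewrite -EFinD subr0.
  by rewrite (_ : t = 0) ?mulr0//; apply/eqP; rewrite eq_le t0 t0'.
apply: le_Rintegral => //.
- exact: integrable_norm.
- apply: continuous_compact_integrable; first exact: segment_compact.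
  by apply: continuous_subspaceT => x; exact: cvg_cst.
Qed.

Lemma drift_le (R : realType) (d : nat) (b : 'rV[R]_d -> 'rV[R]_d) (M : R)
    (x : R -> 'rV[R]_d) (t : R) (i : 'I_d) :
  continuous b -> (forall y, enorm (b y) <= M) ->
  {within `[0, +oo[, continuous x} -> 0 <= t ->
  `|\int[lebesgue_measure]_(s in `[0, t]) (b (x s) 0 i)| <= M * t.
Proof.
move=> cb bM cx t0; apply: normr_Rintegral_itv_le => // [|s]; last first.
  exact: le_trans (normr_coord_le_enorm _ _) (bM _).
have cx' : {within `[0, t], continuous x}.
  apply: continuous_subspaceW cx => s /=.
  by rewrite !in_itv/= andbT => /andP[].
have cbi : continuous (fun y => b y 0 i).
  by move=> y; exact: (cvg_comp _ _ (cb y) (@coord_continuous _ _ _ 0 i (b y))).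
by move=> s; exact: (cvg_comp _ _ (cx' s) (cbi (x s))).
Qed.

(** * From a sequence of times to the upper limit *)

Lemma limf_esup_ge_frequently (R : realType) (T : choiceType)
    (X : filteredType T) (f : X -> \bar R) (F : set (set X)) (u : nat -> X)
    (c : \bar R) :
  u @ \oo `=>` F -> (forall N, exists2 n, (N <= n)%N & (c <= f (u n))%E) ->
  (c <= limf_esup f F)%E.
Proof.
move=> uF freq; rewrite limf_esupE; apply: le_ereal_inf_tmp => _ [V FV <-].
have [N _ NV] := uF V FV; have [n Nn cf] := freq N.
by apply: (le_trans cf); apply: ereal_sup_ubound; exists (u n) => //; exact: NV.
Qed.

Lemma log_scale_cvg0 (R : realType) : log_scale R @ \oo --> (0 : R).
Proof.
apply: (@squeeze_cvgr _ _ _ _ (fun=> 0) (@harmonic R)).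
- near=> n; rewrite expR_ge0 /= /log_scale /harmonic expRN.
  rewrite lef_pV2 ?posrE ?expR_gt0//.
  by rewrite (le_trans _ (expR_ge1Dx _))// lerDr.
- exact: cvg_cst.
- exact: cvg_harmonic.
Unshelve. all: by end_near. Qed.

Lemma log_scale_cvg_at_right (R : realType) : log_scale R @ \oo `=>` 0^'+.
Proof.
move=> V V0.
have : \forall n \near \oo, 0 < log_scale R n -> V (log_scale R n).
  exact: (@log_scale_cvg0 R _ V0).
by apply: filterS => n; apply; exact: log_scale_gt0.
Qed.

Unset Implicit Arguments.

Theorem proposition4p5 (R : realType) (d : nat) (d_gt0 : (0 < d)%N)
    (disp : measure_display) (Omega : measurableType disp)
    (P : probability Omega R) (F : R -> set (set Omega))
    (W : R -> Omega -> 'rV[R]_d) (b : 'rV[R]_d -> 'rV[R]_d) :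
  usual_filtration P F ->
  brownian_motion P F W ->
  (exists M : R, forall x, enorm (b x) <= M) ->
  assumption_A1 b ->
  assumption_A2 b ->
  exists2 c : R, 0 < c &
    forall eps : R, 0 < eps ->
    forall X : R -> Omega -> 'rV[R]_d, sde_solution P F W b eps X ->
      {ae P, forall w,
        (c%:E <= limf_esup
          (fun t : R => (enorm (X t w)
             / (eps * Num.sqrt (2 * t * ln (ln (1 / t)))))%:E) 0^'+)%E}.
Proof.
move=> hF hW [M bM] [cb _ _] _; exists (1 / 8) => // eps eps0 X hX.
pose i := Ordinal d_gt0.
have := ae_lil_lower i hF hW.
apply: filterS3 (sde_continuous hX) (sde_eq hX) => w cX eqX lil.
apply: (limf_esup_ge_frequently (@log_scale_cvg_at_right R)) => N.
have M0 : 0 <= M by rewrite (le_trans _ (bM 0))// sqrtr_ge0.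
(* The times are taken below a level at which sqrt t <= eps / (8 (M + 1)), so
   that M * t <= eps * sqrt t / 8 and sqrt t is at most the rate. *)
have := @log_scale_cvg0 R.
move=> /cvgr0_norm_lt /(_ ((eps / (8 * (M + 1))) ^+ 2)) [].
  by rewrite exprn_gt0// divr_gt0// mulr_gt0// ltr_wpDl.
move=> N' _ small.
have [n] := lil (maxn (maxn N N') 1).
rewrite !geq_max => /andP[/andP[Nn N'n] n0] lilW.
exists n => //; move: (small n N'n) lilW.
have := log_scale_gt0 R n.
have := sqrt_log_scale_le_lil_rate R n0.
set t := log_scale R n => rate t0.
have st0 : 0 < Num.sqrt t by rewrite sqrtr_gt0.
rewrite -/(lil_rate t) lee_fin gtr0_norm// => small_t lilW.
have rate0 : 0 < lil_rate t := lt_le_trans st0 rate.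
rewrite ler_pdivlMr ?mulr_gt0//; apply: (le_trans _ (normr_coord_le_enorm _ i)).
have st_small : Num.sqrt t * (8 * (M + 1)) <= eps.
  rewrite -ler_pdivlMr ?mulr_gt0 ?ltr_wpDl//.
  rewrite -[leRHS]gtr0_norm; last by rewrite divr_gt0// mulr_gt0// ltr_wpDl.
  by rewrite -sqrtr_sqr ler_wsqrtr// ltW.
have drift : M * t <= eps * lil_rate t / 8.
  apply: (@le_trans _ _ (eps * Num.sqrt t / 8)); last first.
    by rewrite ler_pM2r// ler_pM2l.
  rewrite -[X in M * X]sqr_sqrtr ?ltW// expr2.
  have := ler_wpM2r (ltW st0) st_small; have := mulr_gt0 st0 st0; lra.
have := drift_le (x := X ^~ w) i cb bM cX (ltW t0).
rewrite (eqX t (ltW t0) i); set D := \int[_]_(_ in _) _ => Dle.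
have epsW : eps * (lil_rate t / 4) <= `|eps * W t w 0 i|.
  by rewrite normrM gtr0_norm// ler_pM2l.
have := ler_normB (D + eps * W t w 0 i) D.
rewrite addrAC subrr add0r; lra.
Qed.
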